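(* Let $d\geq 2$, and let $E\subseteq\mathbb{Z}^d$ satisfy $d^*(E)>0$. Then there exists $q\in\mathbb{N}$ (a positive integer) such that $$q^2\mathbb{Z}\times q^3\mathbb{Z}\times\cdots\times q^d\mathbb{Z}\subseteq\operatorname{TraceSpec}(E).$$ Moreover, $q$ may be chosen depending only on $d$ and on the upper Banach density $d^*(E)$.
   Context: For $E\subseteq\mathbb{Z}^d$, the upper Banach density is $d^*(E)=\limsup_{N\to\infty}\sup_{t\in\mathbb{Z}^d}\frac{|E\cap(t+[-N,N]^d)|}{|[-N,N]^d|}$, where $[-N,N]^d$ denotes the set of integer points in the box. For $A\in\operatorname{Mat}_d(\mathbb{R})$, the characteristic coefficients $c_1(A),\ldots,c_d(A)$ are defined by $\det(xI-A)=x^d-c_1(A)x^{d-1}+c_2(A)x^{d-2}-\cdots+(-1)^dc_d(A)$; equivalently $c_k(A)$ is the sum of the $k\times k$ principal minors of $A$. Write $\mathbf{Tr}(A)=(c_2(A),\ldots,c_d(A))$. For an ordered tuple $\mathbf v=(v_0,\ldots,v_d)$ of vectors in $\mathbb{R}^d$ (not necessarily affinely independent), the edge matrix $A_{\mathbf v}=[\,v_1-v_0\ \cdots\ v_d-v_0\,]$ is the $d\times d$ matrix with columns $v_j-v_0$. For $E\subseteq\mathbb{R}^d$, $\operatorname{TraceSpec}(E)=\{\mathbf{Tr}(A_{\mathbf v}):\mathbf v=(v_0,\ldots,v_d)\in E^{d+1}\}$. *)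

(* Defs.v *)
From HB Require Import structures.
From mathcomp Require Import all_boot all_order all_algebra.
From mathcomp Require Import finmap.
From mathcomp Require Import all_classical all_reals all_analysis.

Set Implicit Arguments.
Unset Strict Implicit.
Unset Printing Implicit Defensive.

Import Order.TTheory GRing.Theory Num.Theory.
Local Open Scope classical_set_scope.
Local Open Scope ring_scope.

(* The integer points of t + [-N, N]^d. *)
Definition box (d : nat) (t : 'cV[int]_d) (N : nat) : set 'cV[int]_d :=
  [set x : 'cV[int]_d | forall i, `|x i 0 - t i 0| <= N%:Z].

(* [fset_set] is only meaningful on finite sets. *)
Lemma finite_box (d : nat) (t : 'cV[int]_d) (N : nat) : finite_set (box t N).
Proof.
pose f (u : {ffun 'I_d -> 'I_(N.*2.+1)}) : 'cV[int]_d :=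
  \col_i (t i 0 + (u i : nat)%:Z - N%:Z).
apply: (@sub_finite_set _ _ (range f)); last exact: finite_image.
move=> x xb.
exists [ffun i => inord (absz (x i 0 - t i 0 + N%:Z))] => //.
apply/colP => i; rewrite mxE ffunE.
have := xb i; rewrite ler_norml => /andP[lo hi].
have ge0 : 0 <= x i 0 - t i 0 + N%:Z by rewrite -lerBlDr sub0r.
rewrite inordK; last first.
  rewrite ltnS -lez_nat gez0_abs// -addnn PoszD.
  by rewrite lerD2r.
by rewrite gez0_abs// addrA addrK addrC subrK.
Qed.

(* All the quotients lie in [0, 1], so the real-valued [sup] and [limn_sup]
   are the genuine supremum and limit superior. *)
Definition upper_banach_density (R : realType) (d : nat)
    (E : set 'cV[int]_d) : R :=
  limn_sup (fun N : nat =>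
    sup [set (#|` fset_set (E `&` box t N)|%:R
              / #|` fset_set (box (0 : 'cV[int]_d) N)|%:R : R)
        | t in [set: 'cV[int]_d]]).

(* det(xI - A) = \sum_(0 <= k <= d) (-1)^k c_k(A) x^(d - k); meaningful for
   k <= d. *)
Definition char_coef (R : realType) (d : nat) (A : 'M[R]_d) (k : nat) : R :=
  (-1) ^+ k * (char_poly A)`_(d - k).

(* (c_2(A), ..., c_d(A)); the index i : 'I_(d - 1) stands for k = i + 2. *)
Definition Tr (R : realType) (d : nat) (A : 'M[R]_d) : 'rV[R]_(d - 1) :=
  \row_i char_coef A (i + 2).

Definition edge_mx (R : realType) (d : nat) (v : 'I_d.+1 -> 'cV[R]_d) :
    'M[R]_d :=
  \matrix_(i, j) (v (lift ord0 j) - v ord0) i 0.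

Definition TraceSpec (R : realType) (d : nat) (E : set 'cV[R]_d) :
    set 'rV[R]_(d - 1) :=
  [set Tr (edge_mx v) | v in [set v : 'I_d.+1 -> 'cV[R]_d | forall j, E (v j)]].

Definition embedZ (R : realType) (d : nat) (E : set 'cV[int]_d) :
    set 'cV[R]_d :=
  [set map_mx (intr : int -> R) x | x in E].

(* q^2 Z x q^3 Z x ... x q^d Z, indexed as in [Tr]. *)
Definition power_lattice (R : realType) (d q : nat) : set 'rV[R]_(d - 1) :=
  [set w : 'rV[R]_(d - 1) | forall i, exists z : int,
     w 0 i = q%:R ^+ (i + 2) * z%:~R].

Arguments power_lattice : clear implicits.
Arguments upper_banach_density : clear implicits.
Arguments embedZ : clear implicits.

(* Main.v *)
Require Import Defs.
From mathcomp Require Import all_boot all_order all_algebra.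
From mathcomp Require Import all_classical all_reals all_analysis.
From mathcomp Require Import finmap lra ring zify.

Set Implicit Arguments.
Unset Strict Implicit.
Unset Printing Implicit Defensive.

Import Order.TTheory GRing.Theory Num.Theory.
Import numFieldNormedType.Exports.
Local Open Scope classical_set_scope.
Local Open Scope ring_scope.

(** Write [d = m + 1], with coordinates [0, ..., m] and standard basis [e_j].
    The simplices found in [E] come from a companion-like matrix: one sending
    [e_j] to a multiple [l_j e_(j+1)] for [j < m], and [e_m] to an arbitrary
    column. Its characteristic coefficients can be read off that column, and
    the last entry of the column only influences [c_1], which is free.
    Conjugating by the shear that sends [e_m] to
    [u_y = e_m + \sum_(k < m) y_k e_k] preserves the characteristic polynomial,
    and yields edges [l_j e_(j+1)] for [j < m - 1], then [l_(m-1) u_y], and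
    finally [p + t u_y] with [t] free; here [p] is determined by the targets,
    the [l_j] and [y] (lemma [char_poly_edges]). Hence it suffices to find
    some [y], some [l_j] and a point [v] of [E] such that [v + l_j f_j] and
    [v + p + t u_y] lie in [E] for all [j] and some [t], where the [f_j] are
    the sheared basis vectors.

    A translation-invariant mean [L] on bounded functions on [Z^d] with
    [L(1_E) > 0] comes from averages over boxes on which [E] is dense, along
    an ultrafilter ([density_mean]). Poincare recurrence gives bounded [l_j],
    which may be taken divisible by any prescribed [N], for which the set
    [B_y] of points [v] of [E] with all [v + l_j f_j] in [E] has mean at least
    [c > 0], where [c] does not depend on [y] or on [N]
    ([multiple_recurrence]).

    The free parameter [t] takes care of the last edge. Let
    [X_y = B_y + Z u_y]. If no point of [B_y] can be completed, then [E] does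
    not meet [X_y + p]; so [1_E] has correlation at least [c] with
    [1_(X_y) - 1_(X_y + p)]. Along a line of parameters [y] in the [k]-th
    direction, the lattice spanned by two of the [u_y] contains a multiple of
    [e_k] that depends only on the range of [y]. If [p] is a multiple of [e_k]
    with coefficient divisible by that multiple, then the functions
    [1_(X_y) - 1_(X_y + p)] are [u_y]-invariant and, by invariance of [L],
    exactly orthogonal to each other ([bessel_directions]); Bessel's
    inequality bounds how many of them can correlate with [1_E]. For general
    [p] in [N Z^m], [1_(X_y) - 1_(X_y + p)] is telescoped coordinate by
    coordinate and the bound is averaged over all lines of a grid of
    parameters ([grid_bessel]). A large enough grid, whose size only depends
    on [c] and [m], therefore contains a [y] for which the simplex exists
    ([simplex_pattern]). All divisibility requirements are met by targets in
    [q^2 Z x ... x q^d Z] once [q] is a multiple of [N] and of all possible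
    [l_j], and these only depend on [d] and on a lower bound for the density. *)

(** * Invariant means and recurrence *)

Section InvariantMean.
Variables (R : realType) (V : zmodType).
Implicit Types (f g : V -> R) (B E : set V).

Definition bounded_fct f := exists M, forall x, `|f x| <= M.

(** [L] is only constrained on bounded functions, and only finitely additive:
    no limit may be taken inside it. *)
Record invariant_mean (L : (V -> R) -> R) : Prop := InvariantMean {
  meanD : forall f g, bounded_fct f -> bounded_fct g -> L (fun x => f x + g x) = L f + L g;
  meanZ : forall a f, bounded_fct f -> L (fun x => a * f x) = a * L f;
  mean_ge0 : forall f, bounded_fct f -> (forall x, 0 <= f x) -> 0 <= L f;
  mean1 : L (fun=> 1) = 1;
  meanT : forall v f, bounded_fct f -> L (fun x => f (x + v)) = L f }.

Lemma bounded_fct_cst a : bounded_fct (fun=> a).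
Proof. by exists `|a|. Qed.

Lemma bounded_fctD f g : bounded_fct f -> bounded_fct g -> bounded_fct (fun x => f x + g x).
Proof.
move=> [M fM] [N gN]; exists (M + N) => x.
by rewrite (le_trans (ler_normD _ _))// lerD.
Qed.

Lemma bounded_fctM f g : bounded_fct f -> bounded_fct g -> bounded_fct (fun x => f x * g x).
Proof.
by move=> [M fM] [N gN]; exists (M * N) => x; rewrite normrM ler_pM.
Qed.

Lemma bounded_fctT v f : bounded_fct f -> bounded_fct (fun x => f (x + v)).
Proof. by move=> [M fM]; exists M => x. Qed.

Lemma bounded_fctB f g : bounded_fct f -> bounded_fct g -> bounded_fct (fun x => f x - g x).
Proof.
move=> bf bg; have := bounded_fctD bf (bounded_fctM (bounded_fct_cst (-1)) bg).
by under eq_fun do rewrite mulN1r.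
Qed.

Lemma bounded_fct_sum (I : Type) (s : seq I) (F : I -> V -> R) :
  (forall i, bounded_fct (F i)) -> bounded_fct (fun x => \sum_(i <- s) F i x).
Proof.
move=> bF; elim: s => [|i s IH].
  by under eq_fun do rewrite big_nil; exact: bounded_fct_cst.
by under eq_fun do rewrite big_cons; exact: bounded_fctD.
Qed.

Lemma bounded_fct_indic B : bounded_fct (\1_B : V -> R).
Proof. by exists 1 => x; rewrite indicE; case: (_ \in _); rewrite ?normr1 ?normr0. Qed.

Variable L : (V -> R) -> R.
Hypothesis mL : invariant_mean L.

Lemma meanB f g : bounded_fct f -> bounded_fct g -> L (fun x => f x - g x) = L f - L g.
Proof.
move=> bf bg; under eq_fun do rewrite -mulN1r.
by rewrite meanD// ?meanZ ?mulN1r//; apply: bounded_fctM => //; exact: bounded_fct_cst.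
Qed.

Lemma mean_sum (I : Type) (s : seq I) (F : I -> V -> R) :
  (forall i, bounded_fct (F i)) ->
  L (fun x => \sum_(i <- s) F i x) = \sum_(i <- s) L (F i).
Proof.
move=> bF; elim: s => [|i s IH].
  under eq_fun do rewrite big_nil; rewrite big_nil.
  by rewrite -[RHS](mul0r (L (fun=> 0))) -(meanZ mL 0 (bounded_fct_cst 0)) mul0r.
under eq_fun do rewrite big_cons.
by rewrite big_cons meanD// ?IH//; exact: bounded_fct_sum.
Qed.

Lemma le_mean f g : bounded_fct f -> bounded_fct g -> (forall x, f x <= g x) -> L f <= L g.
Proof.
move=> bf bg fg; rewrite -subr_ge0 -meanB// mean_ge0//; first exact: bounded_fctB.
by move=> x; rewrite subr_ge0.
Qed.

(** Positivity of [L] on the square of [g - L(f g) f]. *)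
Lemma mean_cauchy_schwarz f g : bounded_fct g -> (forall x, `|f x| <= 1) ->
  L (fun x => f x * g x) ^+ 2 <= L (fun x => g x ^+ 2).
Proof.
move=> bg f1; have bf : bounded_fct f by exists 1.
set a := L _.
have bfg := bounded_fctM bf bg.
have bff := bounded_fctM bf bf.
have bgg := bounded_fctM bg bg.
have h0 : 0 <= L (fun x => (g x - a * f x) * (g x - a * f x)).
  apply: mean_ge0 => //; last by move=> x; rewrite -expr2 sqr_ge0.
  by apply: bounded_fctM; apply: bounded_fctB => //; apply: bounded_fctM => //; exact: bounded_fct_cst.
have e : (fun x => (g x - a * f x) * (g x - a * f x)) =
   (fun x => (g x * g x + a ^+ 2 * (f x * f x)) - (2 * a) * (f x * g x)).
  by apply/funext => x; ring.
rewrite e meanB ?meanD ?meanZ// in h0; last 3 first.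
- by apply: bounded_fctM => //; exact: bounded_fct_cst.
- by apply: bounded_fctD => //; apply: bounded_fctM => //; exact: bounded_fct_cst.
- by apply: bounded_fctM => //; exact: bounded_fct_cst.
have h1 : L (fun x => f x * f x) <= 1.
  rewrite -(mean1 mL); apply: le_mean => //; first exact: bounded_fct_cst.
  by move=> x; rewrite -expr2 -real_normK ?num_real// expr_le1.
under eq_fun do rewrite expr2.
rewrite -/a in h0.
have := sqr_ge0 a; nra.
Qed.

(** Poincare recurrence: if the translates of [B] by [0, w, ..., (m - 1) w]
    had pairwise small intersections, the second moment of the sum of their
    indicators would be smaller than the square of its mean. *)
Lemma mean_recurrence B (b : R) (m : nat) (w : V) :
  0 < b -> b <= L \1_B -> 2 < m%:R * b ->
  exists n, [/\ (0 < n)%N, (n < m)%N &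
    b ^+ 2 / 2 <= L \1_[set v | B v /\ B (v + w *+ n)]].
Proof.
move=> b0 bB mb; apply: contrapT => no.
set c := L \1_B in bB.
have small n : (0 < n)%N -> (n < m)%N ->
    L (fun x => \1_B x * \1_B (x + w *+ n)) <= c ^+ 2 / 2.
  move=> n0 nm; rewrite leNgt; apply/negP => lt; apply: no; exists n; split=> //.
  rewrite (_ : \1__ = (fun x => \1_B x * \1_B (x + w *+ n))); last first.
    by rewrite (indicI R B [set v | B (v + w *+ n)]).
  apply: le_trans (ltW lt).
  by rewrite ler_pM2r ?invr_gt0// lerXn2r// nnegrE ltW// (lt_le_trans b0).
pose F (j : 'I_m) x : R := \1_B (x + w *+ j).
have bF j : bounded_fct (F j) by apply: bounded_fctT; exact: bounded_fct_indic.
have bS : bounded_fct (fun x => \sum_j F j x) by exact: bounded_fct_sum.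
have := @mean_cauchy_schwarz (fun=> 1) _ bS (fun=> (ltac:(rewrite normr1) : `|1 : R| <= 1)).
under eq_fun do rewrite mul1r.
rewrite mean_sum// (eq_bigr (fun=> c)); last first.
  by move=> j _; rewrite /F (meanT mL _ (@bounded_fct_indic _)).
rewrite sumr_const card_ord -mulr_natl.
have -> : (fun x => (\sum_j F j x) ^+ 2) =
    (fun x => \sum_i \sum_j F i x * F j x).
  apply/funext => x; rewrite expr2 mulr_suml; apply: eq_bigr => i _.
  by rewrite mulr_sumr.
rewrite mean_sum; last by move=> i; apply: bounded_fct_sum => j; exact: bounded_fctM.
have c0 : 0 < c by exact: lt_le_trans bB.
have FF (i j : 'I_m) : L (fun x => F i x * F j x) <= c * (i == j)%:R + c ^+ 2 / 2.
  wlog ij : i j / (i <= j)%N.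
    move=> W; have [ij|ji] := leqP i j; first exact: W.
    rewrite eq_sym; under eq_fun do rewrite mulrC; exact: W (ltnW ji).
  pose G x : R := \1_B x * \1_B (x + w *+ (j - i)).
  have bG : bounded_fct G by apply: bounded_fctM; [|apply: bounded_fctT]; exact: bounded_fct_indic.
  rewrite (_ : (fun x => F i x * F j x) = (fun x => G (x + w *+ i))); last first.
    by apply/funext => x; rewrite /F /G -addrA -mulrnDr subnKC.
  rewrite (meanT mL _ bG) {bG}/G.
  have [->|ne] := eqVneq i j.
    rewrite subnn mulr1 (_ : L _ = c) ?lerDl ?divr_ge0 ?sqr_ge0//.
    congr L; apply/funext => x; rewrite mulr0n addr0 indicE.
    by case: (_ \in _); rewrite ?mulr1 ?mulr0.
  rewrite mulr0 add0r; apply: small; last exact: leq_ltn_trans (leq_subr _ _) _.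
  by rewrite subn_gt0 ltn_neqAle ij andbT.
have : \sum_i L (fun x => \sum_j F i x * F j x) <= m%:R * c + (m%:R * c) ^+ 2 / 2.
  apply: (@le_trans _ _ (\sum_(i < m) (c + m%:R * (c ^+ 2 / 2)))).
    apply: ler_sum => i _; rewrite mean_sum; last by move=> j; exact: bounded_fctM.
    apply: (le_trans (ler_sum _ (fun j _ => FF i j))).
    rewrite big_split /= -mulr_sumr (bigD1 i)//= eqxx big1; last first.
      by move=> j /negPf; rewrite eq_sym => ->.
    by rewrite addr0 mulr1 sumr_const card_ord -[_ *+ m]mulr_natl.
  rewrite sumr_const card_ord -mulr_natl.
  by rewrite le_eqVlt; apply/orP; left; apply/eqP; ring.
move=> h1 h2.
have h3 : 2 < m%:R * c by apply: lt_le_trans mb _; rewrite ler_wpM2l.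
nra.
Qed.

End InvariantMean.

(** * Invariant sets in transversal directions *)

Section Patterns.
Variables (R : realType) (V : zmodType).
Implicit Types (B E : set V) (L : (V -> R) -> R).

Lemma indic_le B E x : (B x -> E x) -> \1_B x <= \1_E x :> R.
Proof.
move=> BE; rewrite !indicE ler_nat; case: (boolP (x \in B)) => //.
by move=> /set_mem/BE/mem_set ->.
Qed.

(** The sets are intersected one direction at a time, so each direction gets
    its own multiplier, and simple recurrence suffices. The bounds [c] and [M]
    are uniform in the directions [f]. *)
Lemma multiple_recurrence (r : nat) (b : R) : 0 < b ->
  exists c M, [/\ 0 < c, (0 < M)%N & forall L, invariant_mean L ->
    forall B, b <= L \1_B -> forall f : nat -> V,
    exists n : nat -> nat,
      (forall j, (j < r)%N -> (0 < n j)%N /\ (n j %| M)%N) /\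
      c <= L \1_[set v | B v /\ forall j, (j < r)%N -> B (v + f j *+ n j)]].
Proof.
move=> b0; elim: r => [|r [c [M [c0 M0 IH]]]].
  exists b, 1%N; split=> // L mL B bB f; exists (fun=> 1%N); split=> //.
  apply: le_trans bB _; apply: (le_mean mL); try exact: bounded_fct_indic.
  by move=> x; exact: indic_le.
pose m := Num.bound (2 / c).
have cm : 2 < m%:R * c.
  by rewrite -ltr_pdivrMr// /m archi_boundP// divr_ge0// ltW.
exists (c ^+ 2 / 2), (M * m`!)%N; split.
- by rewrite divr_gt0// exprn_gt0.
- by rewrite muln_gt0 M0 fact_gt0.
move=> L mL B bB f; have [n [nP cL]] := IH L mL B bB f.
have [k [k0 km kL]] := mean_recurrence mL (f r) c0 cL cm.
exists (fun j => if j == r then k else n j); split=> [j|].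
  rewrite ltnS leq_eqVlt => /predU1P[->|jr].
    by rewrite eqxx k0 dvdn_mull// dvdn_fact// k0 ltnW.
  by rewrite ltn_eqF//; have [? ?] := nP _ jr; rewrite dvdn_mulr.
apply: le_trans kL _; apply: (le_mean mL); try exact: bounded_fct_indic.
move=> x; apply: indic_le => -[[Bx Bj] [Bk _]]; split=> // j.
rewrite ltnS leq_eqVlt => /predU1P[->|jr]; first by rewrite eqxx.
by rewrite ltn_eqF//; exact: Bj.
Qed.

(** The functions [h_j = phi_j - phi_j(. - w_j)] are pairwise orthogonal:
    modulo the [u_i]-invariance of [phi_i], translating by [w_i] amounts to
    translating by a multiple of [u_j], which leaves [h_j] and the mean
    unchanged. The conclusion is Bessel's inequality for this family. *)
Lemma bessel_directions L (K : nat) (g : V -> R) (phi : 'I_K -> V -> R) (u w : 'I_K -> V) :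
  invariant_mean L -> (forall x, `|g x| <= 1) ->
  (forall j x, 0 <= phi j x <= 1) ->
  (forall j x s, phi j (x + u j *~ s) = phi j x) ->
  (forall i j, i != j -> exists s t, w i = u i *~ s + u j *~ t) ->
  (\sum_j L (fun x => g x * (phi j x - phi j (x - w j)))) ^+ 2 <= K%:R.
Proof.
move=> mL g1 phi01 phiu wP.
pose h j x := phi j x - phi j (x - w j).
have bphi j : bounded_fct (phi j).
  by exists 1 => x; have /andP[? ?] := phi01 j x; rewrite ger0_norm.
have h1 j x : `|h j x| <= 1.
  have /andP[? ?] := phi01 j x; have /andP[? ?] := phi01 j (x - w j).
  by rewrite ler_norml /h; apply/andP; split; lra.
have bg : bounded_fct g by exists 1.
have bh j : bounded_fct (h j) by exists 1.
have hu j x s : h j (x + u j *~ s) = h j x.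
  by rewrite /h phiu addrAC phiu.
rewrite -(mean_sum mL); last by move=> j; exact: bounded_fctM bg (bh j).
under eq_fun do rewrite -mulr_sumr.
apply: le_trans (mean_cauchy_schwarz mL (bounded_fct_sum _ bh) g1) _.
rewrite (_ : (fun x => _) = (fun x => \sum_i \sum_j h i x * h j x)); last first.
  apply/funext => x; rewrite expr2 mulr_suml; apply: eq_bigr => i _.
  by rewrite mulr_sumr.
rewrite (mean_sum mL); last by move=> i; apply: bounded_fct_sum => j; exact: bounded_fctM.
rewrite -[leRHS](_ : \sum_(i < K) 1 = _); last by rewrite sumr_const card_ord.
apply: ler_sum => i _.
rewrite (mean_sum mL); last by move=> j; exact: bounded_fctM.
rewrite (bigD1 i)//= big1 ?addr0.
  rewrite -(mean1 mL); apply: (le_mean mL); [exact: bounded_fctM|exact: bounded_fct_cst|move=> x].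
  by rewrite -expr2 -real_normK ?num_real// expr_le1.
move=> j; rewrite eq_sym => /wP[s [t wE]].
pose G x := phi i x * h j x.
have bG : bounded_fct G by exact: bounded_fctM.
rewrite (_ : (fun x => _) = (fun x => G x - G (x - u j *~ t))).
  by rewrite (meanB mL) ?(meanT mL _ bG) ?subrr//; exact: bounded_fctT.
apply/funext => x.
have hj : h j (x - u j *~ t) = h j x by rewrite -mulrNz hu.
have phw : phi i (x - w i) = phi i (x - u j *~ t).
  by rewrite wE opprD addrCA addrC -(mulrNz (u i)) phiu.
by rewrite /G hj -phw -mulrBl.
Qed.

(** The parameters [y] form the group (Z/(K+1))^m, only so that summing over
    all lines parallel to an axis is a reindexing by translations. Two
    distinct parameters on a line parallel to the [k]-th axis have directions
    that differ by [d eps k] with [0 < |d| <= K]; as [d] divides [N], these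
    directions span every multiple of [N eps k]. *)
Lemma grid_bessel L (K N m : nat) (c : R) (g : V -> R) (e : V)
    (eps : 'I_m -> V) (G := {ffun 'I_m -> 'I_K.+1})
    (phi : G -> V -> R) (r : G -> 'I_m -> int) :
  invariant_mean L -> (forall x, `|g x| <= 1) -> 0 <= c ->
  (forall k, (0 < k <= K)%N -> (k %| N)%N) ->
  (forall y x, 0 <= phi y x <= 1) ->
  (forall y x s, phi y (x + (e + \sum_k eps k *+ y k) *~ s) = phi y x) ->
  (forall y, c <= L (fun x =>
     g x * (phi y x - phi y (x - \sum_k eps k *~ (N%:Z * r y k))))) ->
  K.+1%:R * c ^+ 2 <= m%:R ^+ 2.
Proof.
move=> mL g1 c0 NP phi01 phiu cL.
pose w y k := eps k *~ (N%:Z * r y k).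
(* The displacement is split along the axes; [h y k] is the contribution of
   its [k]-th component to the telescoping sum. *)
pose P y k := \sum_(i < m | (i < k)%N) w y i.
pose h y (k : 'I_m) x := phi y (x - P y k) - phi y (x - w y k - P y k).
pose a y k := L (fun x => g x * h y k x).
have bg : bounded_fct g by exists 1.
have bphi y : bounded_fct (phi y).
  by exists 1 => x; have /andP[? ?] := phi01 y x; rewrite ger0_norm.
have PS y (k : 'I_m) : P y k.+1 = w y k + P y k.
  rewrite /P (bigD1 k)//=; congr (_ + _); apply: eq_bigl => i.
  by rewrite ltnS ltn_neqAle andbC.
have bh y k : bounded_fct (h y k).
  apply: bounded_fctB; first exact: (bounded_fctT (- P y k) (bphi y)).
  exact: (bounded_fctT (- w y k) (bounded_fctT (- P y k) (bphi y))).
have ca y : c <= \sum_k a y k.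
  rewrite -(mean_sum mL); last by move=> k; exact: bounded_fctM.
  apply: le_trans (cL y) _; rewrite le_eqVlt; apply/orP; left; apply/eqP.
  congr L; apply/funext => x; rewrite -mulr_sumr; congr (_ * _).
  pose F k := - phi y (x - P y k).
  have := telescope_sumr F (leq0n m).
  have P0 : P y 0%N = 0 by rewrite /P big_pred0.
  have Pm : P y m = \sum_k w y k by apply: eq_bigl => i; exact: ltn_ord.
  rewrite big_mkord [in RHS]/F P0 Pm subr0 opprK addrC => <-.
  by apply: eq_bigr => i _; rewrite /F /h PS opprK addrC opprD addrA.
(* [y + dl k j], for [j] in Z/(K+1), is the line through [y] along axis [k]. *)
pose dl (k : 'I_m) (j : 'I_K.+1) : G := [ffun i => if i == k then j else 0].
have line (y : G) (k : 'I_m) : \sum_j a (y + dl k j) k <= Num.sqrt K.+1%:R.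
  apply: le_trans (ler_norm _) _; rewrite -sqrtr_sqr ler_wsqrtr//.
  apply: (@bessel_directions L K.+1 g (fun j x => phi (y + dl k j) (x - P (y + dl k j) k))
    (fun j => e + \sum_i eps i *+ (y + dl k j)%R i)
    (fun j => w (y + dl k j) k) mL g1) => //.
  - by move=> j x s; rewrite addrAC phiu.
  move=> i j ij.
  pose v l : 'I_K.+1 := (y + dl k l)%R k.
  pose d : int := (v i : nat)%:Z - (v j : nat)%:Z.
  have d0 : d != 0.
    rewrite subr_eq0; apply: contraNneq ij => /eqP; rewrite eqz_nat => /eqP/val_inj.
    by rewrite /v !ffunE eqxx => /addrI ->.
  have dN : (d %| N%:Z)%Z.
    rewrite dvdzE; apply: NP; rewrite absz_gt0 d0/=.
    have := ltn_ord (v i); have := ltn_ord (v j); rewrite /d; lia.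
  have ue : eps k *~ d = (e + \sum_l eps l *+ (y + dl k i)%R l) -
                      (e + \sum_l eps l *+ (y + dl k j)%R l).
    rewrite opprD addrACA subrr add0r -sumrB (bigD1 k)//= big1 => [|l lk].
      by rewrite addr0 mulrzBr !pmulrn.
    by rewrite !ffunE (negPf lk) subrr.
  have /dvdzP[q qE] := dN.
  exists (q * r (y + dl k i) k), (- (q * r (y + dl k i) k)).
  by rewrite mulrNz -mulrzBl -ue -mulrzA /w qE; congr (_ *~ _); ring.
(* Each point of the grid lies on K + 1 parametrized lines along each axis. *)
have tot : #|G|%:R * (K.+1%:R * c) <= #|G|%:R * (m%:R * Num.sqrt K.+1%:R).
  apply: (@le_trans _ _ (\sum_(y : G) \sum_(k < m) \sum_(j < K.+1) a (y + dl k j) k)).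
    rewrite exchange_big /=.
    rewrite (eq_bigr (fun k => \sum_(j < K.+1) \sum_(y : G) a y k)) => [|k _]; last first.
      rewrite exchange_big; apply: eq_bigr => j _ /=.
      rewrite [RHS](reindex_inj (addIr (dl k j))) /=.
      by apply: eq_bigr.
    rewrite exchange_big /= sumr_const card_ord -[leRHS]mulr_natl mulrCA.
    rewrite ler_wpM2l// exchange_big /= mulr_natl -sumr_const.
    exact: ler_sum.
  apply: (@le_trans _ _ (\sum_(y : G) \sum_(k < m) Num.sqrt K.+1%:R)).
    by apply: ler_sum => y _; apply: ler_sum.
  by rewrite !sumr_const card_ord -[leLHS]mulr_natl -[_ *+ m]mulr_natl.
have G0 : 0 < #|G|%:R :> R.
  by rewrite ltr0n; apply/card_gt0P; exists 0.
rewrite ler_pM2l// in tot.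
have : (K.+1%:R * c) ^+ 2 <= (m%:R * Num.sqrt K.+1%:R) ^+ 2.
  by rewrite lerXn2r// nnegrE mulr_ge0// sqrtr_ge0.
rewrite !exprMn sqr_sqrtr// expr2 -mulrA mulrC ler_pM2r ?ltr0n//.
Qed.

(** [f] and [r] may depend on the parameters in any way, [r] also on the
    multipliers [n] returned by recurrence. [N] is a factorial that makes the
    grid lines satisfy the divisibility of [grid_bessel]. *)
Lemma simplex_pattern (m : nat) (b : R) : 0 < b ->
  exists N M, [/\ (0 < N)%N, (0 < M)%N & forall L, invariant_mean L ->
    forall E, b <= L \1_E ->
    forall (e : V) (eps : nat -> V) (f : (nat -> nat) -> nat -> V)
      (r : (nat -> nat) -> (nat -> nat) -> nat -> int),
    exists y n v t,
      [/\ forall j, (j < m)%N -> (0 < n j)%N /\ (n j %| M)%N,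
          E v,
          forall j, (j < m)%N -> E (v + f y j *+ (N * n j)) &
          E (v + \sum_(k < m) eps k *~ (N%:Z * r y n k) +
             (e + \sum_(k < m) eps k *+ y k) *~ t)]].
Proof.
move=> b0; have [c [M [c0 M0 rec]]] := multiple_recurrence m b0.
pose K := Num.bound (m%:R ^+ 2 / c ^+ 2).
have Kc : m%:R ^+ 2 < K.+1%:R * c ^+ 2.
  rewrite -ltr_pdivrMr ?exprn_gt0// (@lt_trans _ _ K%:R) ?ltr_nat//.
  by rewrite /K archi_boundP// divr_ge0// exprn_ge0// ltW.
exists K.+1`!, M; split=> //; first exact: fact_gt0.
set N := K.+1`!.
move=> L mL E bE e eps f r; apply: contrapT => no.
pose G := {ffun 'I_m -> 'I_K.+1}.
pose ext (y : G) k : nat := oapp (fun i => nat_of_ord (y i)) 0%N (insub k).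
have extE y (k : 'I_m) : ext y k = y k by rewrite /ext valK.
pose u (y : G) := e + \sum_(k < m) eps k *+ ext y k.
pose Bs (n : nat -> nat) y :=
  [set v | E v /\ forall j, (j < m)%N -> E (v + f y j *+ N *+ n j)].
have /choice [n nP] : forall y : G, exists n : nat -> nat,
   (forall j, (j < m)%N -> (0 < n j)%N /\ (n j %| M)%N) /\
   c <= L \1_(Bs n (ext y)).
  by move=> y; exact: rec.
pose B y := Bs (n y) (ext y).
pose X y := [set x | exists t, B y (x + u y *~ t)].
pose p (y : G) := \sum_(k < m) eps k *~ (N%:Z * r (ext y) (n y) k).
(* A point of [E] in [X y + p y] would complete a simplex. *)
have Xp y x : E x -> ~ X y (x - p y).
  move=> Ex [t [Bt Btj]]; apply: no.
  exists (ext y), (n y), (x - p y + u y *~ t), (- t); split=> //.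
  - by have [] := nP y.
  - by move=> j jm; rewrite mulrnA; exact: Btj.
  - by rewrite mulrNz addrAC -/(u y) addrK subrK.
have XB y x : B y x -> X y x by move=> Bx; exists 0; rewrite mulr0z addr0.
suff : K.+1%:R * c ^+ 2 <= m%:R ^+ 2 by rewrite leNgt Kc.
apply: (@grid_bessel L K N m c \1_E e eps (fun y => \1_(X y))
  (fun y => r (ext y) (n y)) mL _ (ltW c0)).
- by move=> x; rewrite indicE; case: (_ \in _); rewrite ?normr1 ?normr0.
- by move=> k /andP[k0 kK]; rewrite dvdn_fact// k0 ltnW.
- by move=> y x; rewrite indicE; case: (_ \in _); rewrite ?lexx ?ler01.
- move=> y x s; rewrite (eq_bigr (fun k : 'I_m => eps k *+ ext y k)); last first.
    by move=> k _; rewrite extE.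
  rewrite !indicE; congr (nat_of_bool _)%:R; apply: asbool_equiv_eq.
  split=> -[t]; rewrite -/(u y).
    by rewrite -addrA -mulrzDr; exists (s + t).
  by move=> ?; exists (t - s); rewrite -addrA -mulrzDr subrKC.
move=> y; have [_ cy] := nP y; apply: le_trans cy _.
apply: (le_mean mL).
- exact: bounded_fct_indic.
- by apply: bounded_fctM; [|apply: bounded_fctB; [|apply: bounded_fctT]]; exact: bounded_fct_indic.
move=> x; rewrite -/(p y).
have [/set_mem Ex|nEx] := boolP (x \in E); last first.
  rewrite [\1_E x]indicE (negPf nEx) mul0r.
  suff: \1_(Bs (n y) (ext y)) x <= \1_(@set0 V) x :> R by rewrite indic0.
  by apply: indic_le => -[/mem_set]; rewrite (negPf nEx).
rewrite [\1_E x]indicE mem_set// mul1r.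
rewrite [\1_(X y) (x - p y)]indicE memNset ?subr0; last exact: Xp.
by apply: indic_le; exact: XB.
Qed.

End Patterns.

(** * A mean that sees the upper Banach density *)

Section DensityMean.
Variables (R : realType) (d : nat).
Notation V := 'cV[int]_d.
Implicit Types (f : V -> R) (t v : V) (N : nat) (E : set V).

Lemma card_box t N : #|` fset_set (box t N)| = (N.*2.+1 ^ d)%N.
Proof.
pose pt (u : {ffun 'I_d -> 'I_(N.*2.+1)}) : V :=
  \col_i (t i 0 + (u i : nat)%:Z - N%:Z).
have pt_inj : injective pt.
  move=> u u' /colP uu'; apply/ffunP => i; apply: val_inj => /=.
  by have := uu' i; rewrite !mxE => /addIr/addrI[].
have -> : fset_set (box t N) = [fset pt u | u in {ffun 'I_d -> 'I_(N.*2.+1)}]%fset.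
  apply/fsetP => x; rewrite in_fset_set; last exact: finite_box.
  apply/idP/imfsetP => [/set_mem xb|[u _ ->]]; last first.
    apply/mem_set => i; rewrite mxE.
    by move: (t i 0) (nat_of_ord (u i)) (ltn_ord (u i)) => a b; lia.
  exists [ffun i => inord (absz (x i 0 - t i 0 + N%:Z))] => //.
  apply/colP => i; have := xb i; rewrite mxE ffunE => xi.
  by rewrite inordK; move: (x i 0) (t i 0) xi => a b; lia.
by rewrite card_imfset//= -cardE card_ffun !card_ord.
Qed.

Definition avg t N f : R := (\sum_(x <- fset_set (box t N)) f x) / (N.*2.+1 ^ d)%:R.

Lemma avg_den_gt0 N : 0 < (N.*2.+1 ^ d)%:R :> R.
Proof. by rewrite ltr0n expn_gt0. Qed.

Lemma avgT t v N f : avg t N (fun x => f (x + v)) = avg (t + v) N f.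
Proof.
rewrite /avg; congr (_ / _).
have -> : fset_set (box (t + v) N) = [fset (x + v)%R | x in fset_set (box t N)]%fset.
  apply/fsetP => x; rewrite in_fset_set; last exact: finite_box.
  apply/idP/imfsetP => [/set_mem xb|[y]]; last first.
    rewrite /= in_fset_set; last exact: finite_box.
    move=> /set_mem yb ->; apply/mem_set => i; have := yb i; rewrite !mxE.
    by move: (y i 0) (t i 0) (v i 0) => a b c; lia.
  exists (x - v); last by rewrite subrK.
  rewrite /= in_fset_set; last exact: finite_box.
  apply/mem_set => i; have := xb i; rewrite !mxE.
  by move: (x i 0) (t i 0) (v i 0) => a b c; lia.
by rewrite big_imfset //= => x y _ _; exact: addIr.
Qed.

Lemma avg_le t N f M : (forall x, `|f x| <= M) -> `|avg t N f| <= M.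
Proof.
move=> fM; rewrite normrM normfV (gtr0_norm (avg_den_gt0 N)).
rewrite ler_pdivrMr ?avg_den_gt0//.
apply: le_trans (ler_norm_sum _ _ _) _.
apply: le_trans (ler_sum _ (fun x _ => fM x)) _.
by rewrite big_const_seq count_predT iter_addr_0 (card_box t N) mulr_natr.
Qed.

Lemma bernoulli (n : nat) (s : R) : 0 <= s <= 1 -> 1 - n%:R * s <= (1 - s) ^+ n.
Proof.
move=> /andP[s0 s1]; elim: n => [|n IH]; first by rewrite mul0r subr0 expr0.
rewrite exprS; apply: (@le_trans _ _ ((1 - s) * (1 - n%:R * s))).
  by rewrite -natr1; have := ler0n R n; nra.
by rewrite ler_wpM2l// subr_ge0.
Qed.

(** Both boxes contain the concentric box of radius [N - r], whose relative
    size is at least [1 - 2 d r / (2 N + 1)] by Bernoulli's inequality. *)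
Lemma avg_shift t v N (r : nat) f M : (forall i, `|v i 0| <= r%:Z) ->
  (r <= N)%N -> (forall x, `|f x| <= M) ->
  `|avg (t + v) N f - avg t N f| <= 4 * M * d%:R * r%:R / N.+1%:R.
Proof.
move=> vr rN fM.
have M0 : 0 <= M by apply: le_trans (fM 0).
pose I := fset_set (box t (N - r)).
have inner t' : (forall i, `|t' i 0 - t i 0| <= r%:Z) ->
    `|\sum_(x <- fset_set (box t' N)) f x - \sum_(x <- I) f x| <=
      M * ((N.*2.+1 ^ d)%:R - ((N - r).*2.+1 ^ d)%:R).
  move=> tt'.
  have sub : (I `<=` fset_set (box t' N))%fset.
    apply/fsubsetP => x; rewrite !in_fset_set; [|exact: finite_box..].
    move=> /set_mem xI; apply/mem_set => i; have := xI i; have := tt' i.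
    by move: (x i 0) (t i 0) (t' i 0) => a b c; lia.
  rewrite (big_fsetID _ (mem I)) /=.
  have e : [fset x in fset_set (box t' N) | x \in I]%fset = I.
    apply/fsetP => x; rewrite !inE /=; apply: andb_idl; exact: (fsubsetP sub).
  have e2 : [fset x in fset_set (box t' N) | x \notin I]%fset =
      (fset_set (box t' N) `\` I)%fset.
    by apply/fsetP => x; rewrite !inE /= andbC.
  rewrite e e2 addrAC subrr add0r.
  apply: le_trans (ler_norm_sum _ _ _) _.
  apply: le_trans (ler_sum _ (fun x _ => fM x)) _.
  rewrite big_const_seq count_predT iter_addr_0 -[leLHS]mulr_natr ler_wpM2l//.
  rewrite -(card_box t' N) -(card_box t (N - r)) -/I.
  rewrite -natrB ?fsubset_leq_card//.
  by rewrite -cardfsDS.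
have vE i : `|(t + v) i 0 - t i 0| <= r%:Z by rewrite mxE addrC addKr.
have tE i : `|t i 0 - t i 0| <= r%:Z by rewrite subrr normr0.
have := inner _ vE; have := inner _ tE.
move: (\sum_(x <- I) f x) => SI h1 h2.
rewrite /avg -mulrBl normrM normfV (gtr0_norm (avg_den_gt0 N)).
rewrite ler_pdivrMr ?avg_den_gt0//.
pose s : R := (2 * r%:R) / (N.*2.+1)%:R.
have s01 : 0 <= s <= 1.
  rewrite /s divr_ge0 ?mulr_ge0// ler_pdivrMr ?ltr0n// mul1r -natrM ler_nat; lia.
have := bernoulli d s01.
have -> : 1 - s = ((N - r).*2.+1)%:R / (N.*2.+1)%:R.
  have ne : (N.*2.+1)%:R != 0 :> R by rewrite pnatr_eq0.
  apply: (mulIf ne); rewrite mulrBl !divfK// mul1r -natrM -natrB; last by lia.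
  by congr _%:R; lia.
rewrite expr_div_n -!natrX ler_pdivlMr ?avg_den_gt0// => h3.
have sN : s <= 2 * r%:R / N.+1%:R.
  rewrite /s ler_wpM2l ?mulr_ge0// lef_pV2 ?posrE ?ltr0n// ler_nat; lia.
have a12 : `|\sum_(x <- fset_set (box (t + v) N)) f x -
                   \sum_(x <- fset_set (box t N)) f x| <=
  2 * (M * ((N.*2.+1 ^ d)%:R - ((N - r).*2.+1 ^ d)%:R)).
  rewrite mulr_natl mulr2n.
  by rewrite (le_trans (ler_distD SI _ _))// lerD// distrC.
apply: le_trans a12 _.
have AB : (N.*2.+1 ^ d)%:R - ((N - r).*2.+1 ^ d)%:R <=
    d%:R * (2 * r%:R / N.+1%:R) * (N.*2.+1 ^ d)%:R :> R.
  apply: (@le_trans _ _ (d%:R * s * (N.*2.+1 ^ d)%:R)); first by move: h3; lra.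
  by apply: ler_wpM2r; [exact/ltW/avg_den_gt0|exact: ler_wpM2l].
apply: (@le_trans _ _ (2 * (M * (d%:R * (2 * r%:R / N.+1%:R) * (N.*2.+1 ^ d)%:R)))).
  by rewrite ler_wpM2l// ler_wpM2l.
by rewrite le_eqVlt; apply/orP; left; apply/eqP; ring.
Qed.

(** A cluster point exists by compactness, and an ultrafilter converges to its
    cluster points. *)
Lemma ultra_bounded_cvg (U : set_system nat) (a : nat -> R) M :
  UltraFilter U -> (forall k, `|a k| <= M) -> cvg (a @ U).
Proof.
move=> UU aM.
have FF : ProperFilter (a @ U) by apply: fmap_proper_filter.
have aA : (a @ U) `[- M, M]%classic.
  apply: (@filterS _ U _ setT); last exact: filterT.
  by move=> k _ /=; rewrite in_itv /= -ler_norml.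
have [p [_ cp]] := @segment_compact R (- M) M _ FF aA.
apply/cvg_ex; exists p => B pB.
have [//|UB] := in_ultra_setVsetC (a @^-1` B) UU.
have UB' : (a @ U) (~` B) by exact: UB.
by have [x [nBx Bx]] := cp _ _ UB' pB.
Qed.

(** The mean is the limit of the averages along an ultrafilter finer than the
    neighbourhoods of infinity; it is invariant because the radii tend to
    infinity. *)
Lemma mean_along (t : nat -> V) (N : nat -> nat) : (forall k, (k <= N k)%N) ->
  exists2 L, invariant_mean L & forall f (b : R), bounded_fct f ->
    (forall k, b <= avg (t k) (N k) f) -> b <= L f.
Proof.
move=> kN.
have [U [UU sU]] := ultraFilterLemma (@eventually_filter).
pose a f k := avg (t k) (N k) f.
pose L f : R := lim (a f @ U).
have ca f : bounded_fct f -> cvg (a f @ U).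
  by move=> [M fM]; apply: (ultra_bounded_cvg (M := M)) => k; exact: avg_le.
exists L; last by move=> f b bf bk; apply: limr_ge; [exact: ca|exact: nearW].
split.
- move=> f g bf bg; rewrite /L -limD; [|exact: ca..].
  congr (lim (_ @ U)); apply/funext => k.
  by rewrite /a /avg big_split mulrDl.
- move=> c f bf; apply/cvg_lim => //.
  rewrite (_ : a _ = (fun k => c * a f k)); last first.
    by apply/funext => k; rewrite /a /avg -mulr_sumr mulrA.
  by apply: cvgM; [exact: cvg_cst|exact: ca].
- move=> f bf f0; apply: limr_ge; first exact: ca.
  by apply: nearW => k; rewrite divr_ge0// sumr_ge0.
- rewrite /L (_ : a _ = cst 1) ?lim_cst//; apply/funext => k.
  rewrite /a /avg big_const_seq count_predT iter_addr_0 (card_box (t k)).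
  by rewrite divff// gt_eqF// avg_den_gt0.
- move=> v f bf.
  have [M fM] := bf.
  pose r := (\sum_i `|v i 0%R|)%N.
  have vr i : `|v i 0| <= r%:Z.
    by rewrite -abszE lez_nat /r (bigD1 i)//= leq_addr.
  apply/eqP; rewrite -subr_eq0; apply/eqP.
  rewrite /L -limB; [|exact/ca/bounded_fctT|exact: ca].
  apply/cvg_lim => //.
  have : (fun k => a (fun x => f (x + v)) k - a f k) @ \oo --> (0 : R).
    pose C := 4 * M * d%:R * r%:R.
    have hC : (fun k => C * harmonic k) @ \oo --> (0 : R).
      rewrite -[0](mulr0 C); apply: cvgM; [exact: cvg_cst|exact: cvg_harmonic].
    have hNC : (fun k => - (C * harmonic k)) @ \oo --> (0 : R).
      by rewrite -[0]oppr0; apply: cvgN.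
    apply: squeeze_cvgr hNC hC.
    near=> k; rewrite -ler_norml /a avgT.
    apply: le_trans (avg_shift _ vr _ fM) _.
      by apply: leq_trans (kN k); near: k; exact: nbhs_infty_ge.
    rewrite ler_wpM2l //.
      rewrite /C !mulr_ge0//; exact: le_trans (fM 0).
    by rewrite /harmonic /= lef_pV2 ?posrE ?ltr0n// ler_nat ltnS kN.
  by apply: cvg_trans => B /sU.
Unshelve. all: by end_near. Qed.

Lemma density_boxes E (b : R) : b < upper_banach_density R d E ->
  forall k, exists N t, (k <= N)%N /\ b <= avg t N \1_E.
Proof.
rewrite /upper_banach_density; set u := (X in limn_sup X) => bu k.
have cardE t N : #|` fset_set (E `&` box t N)|%:R
              / #|` fset_set (box (0 : V) N)|%:R = avg t N \1_E :> R.
  rewrite /avg card_box; congr (_ / _).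
  rewrite card_fset_sum1 natr_sum.
  rewrite (_ : fset_set _ = [fset x in fset_set (box t N) | x \in E]%fset).
    rewrite big_fset [LHS]big_mkcond; apply: eq_bigr => x _.
    by rewrite indicE; case: (x \in E).
  apply/fsetP => x; rewrite !inE /= !in_fset_set; [|exact: finite_box|].
    by rewrite in_setI andbC.
  exact: sub_finite_set (@subIsetr _ _ _) (@finite_box _ t N).
have ratio01 t N : 0 <= avg t N \1_E <= 1.
  apply/andP; split; first by rewrite divr_ge0// sumr_ge0.
  apply: le_trans (ler_norm _) (avg_le _ _ _) => x.
  by rewrite indicE; case: (_ \in _); rewrite ?normr1 ?normr0.
have ubu N : ubound [set (#|` fset_set (E `&` box t N)|%:R
    / #|` fset_set (box (0 : V) N)|%:R : R) | t in [set: V]] 1.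
  by move=> _ [t _ <-]; rewrite cardE; have /andP[] := ratio01 t N.
have u01 N : 0 <= u N <= 1.
  apply/andP; split; last by apply: ge_sup => //; eexists; exists 0.
  have /andP[h _] := ratio01 0 N; apply: le_trans h _; rewrite -cardE.
  by apply: ub_le_sup; [exists 1|exists 0].
have bu' : bounded_fun u.
  exists 1; split => // M M1 N _; have /andP[? ?] := u01 N.
  by rewrite /= ger0_norm// (le_trans _ (ltW M1)).
rewrite limn_supE// in bu.
have : b < sups u k.
  apply: lt_le_trans bu _; apply: ge_inf; last by exists k.
  exists 0 => _ [n _ <-]; have /andP[h _] := u01 n; apply: le_trans h _.
  apply: ub_le_sup; last by exists n => /=.
  by exists 1 => _ [j _ <-]; have /andP[] := u01 j.
move/sup_gt => [].
  by exists (u k), k => /=.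
move=> _ [N /= kN <-] /sup_gt[].
  by eexists; exists 0.
move=> _ [t _ <-] bt; exists N, t; split=> //.
by rewrite -cardE ltW.
Qed.

Lemma density_mean E (b : R) : b < upper_banach_density R d E ->
  exists2 L, invariant_mean L & b <= L \1_E.
Proof.
move=> /density_boxes bE.
have /choice[P PE] : forall k, exists p : nat * V,
    (k <= p.1)%N /\ b <= avg p.2 p.1 \1_E.
  by move=> k; have [N [t ?]] := bE k; exists (N, t).
have [L mL Lb] := @mean_along (fun k => (P k).2) (fun k => (P k).1)
  (fun k => (PE k).1).
exists L => //; apply: Lb; first exact: bounded_fct_indic.
by move=> k; have [] := PE k.
Qed.

End DensityMean.

(** * Characteristic polynomials of sheared simplices *)

(** The columns of [B] are the iterates of its first column under [A]. Applying
    Cayley-Hamilton to that column gives a linear relation between the columns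
    of [B], and these are independent. *)
Lemma char_poly_krylov (n : nat) (A B : 'M[int]_n.+1) (a : 'cV[int]_n.+1) :
  (forall j : nat, (j < n)%N -> A *m col (inord j) B = col (inord j.+1) B) ->
  A *m col (inord n) B = B *m a -> \det B != 0 ->
  forall j : 'I_n.+1, (char_poly A)`_j = - a j 0.
Proof.
move=> AB AB' dB.
set chi := char_poly A.
have pw j : (j <= n)%N -> A ^+ j *m col (inord 0) B = col (inord j) B.
  elim: j => [|j IH] jn; first by rewrite expr0 mul1mx.
  by rewrite exprS -mulmxA IH ?AB// ltnW.
have chiE : chi = \sum_(i < n.+2) chi`_i *: 'X^i.
  by rewrite -poly_def -(size_char_poly A) coefK.
have hA : horner_mx A chi = \sum_(i < n.+2) chi`_i *: A ^+ i.
  rewrite {1}chiE linear_sum; apply: eq_bigr => i _.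
  by rewrite linearZ /= rmorphXn /= horner_mx_X.
have lead : chi`_n.+1 = 1.
  by have /monicP := char_poly_monic A; rewrite lead_coefE size_char_poly.
pose x : 'cV_n.+1 := \col_i chi`_i + a.
have Bx : B *m x = 0.
  have := congr1 (fun C => C *m col (inord 0) B) (Cayley_Hamilton A).
  rewrite mul0mx -/chi hA mulmx_suml big_ord_recr /= lead scale1r exprS -mulmxA.
  rewrite pw// AB' => <-; rewrite mulmxDr; congr (_ + _).
  rewrite (eq_bigr (fun i : 'I_n.+1 => chi`_i *: col i B)); last first.
    by move=> i _; rewrite -scalemxAl pw ?inord_val// -ltnS.
  apply/colP => k; rewrite !mxE summxE; apply: eq_bigr => i _.
  by rewrite !mxE mulrC.
have x0 : x = 0.
  have := congr1 (mulmx (\adj B)) Bx.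
  rewrite mulmx0 mulmxA mul_adj_mx mul_scalar_mx => /colP dx.
  apply/colP => i; have /eqP := dx i.
  by rewrite !mxE mulf_eq0 (negPf dB) => /eqP.
move=> j; have /colP/(_ j) := x0; rewrite !mxE => /eqP.
by rewrite addr_eq0 => /eqP.
Qed.

Section Simplex.
Variables (m' : nat).
Notation m := m'.+1.
Notation V := 'cV[int]_m.+1.
Variables (y : nat -> nat) (len p0 : nat -> int) (tau : int).

Definition basis_vec (j : nat) : V := \col_i ((i : nat) == j)%:R.
Definition shear_dir : V := basis_vec m + \sum_(k < m) basis_vec k *+ y k.
Definition sheared_basis (j : nat) : V := if j == m then shear_dir else basis_vec j.
(** The correction by the previous coordinate cancels, in the image of
    [shear_dir] under [edges], the images of its components along
    [basis_vec k]. *)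
Definition last_coef (k : nat) : int :=
  p0 k - (if k is k'.+1 then (y k')%:Z * len k' else 0).
Definition last_edge : V := \sum_(k < m) basis_vec k *~ last_coef k + shear_dir *~ tau.
Definition edges : 'M[int]_m.+1 :=
  \matrix_(i, j) (if (j < m)%N then sheared_basis j.+1 *~ len j else last_edge) i 0.

Lemma scalez (v : V) z : v *~ z = z *: v.
Proof. by rewrite -scaler_int intz. Qed.

Lemma basis_vecE (j : 'I_m.+1) : basis_vec j = delta_mx j 0.
Proof. by apply/colP => i; rewrite !mxE eqxx andbT. Qed.

Lemma edges_basis_vec (j : 'I_m.+1) :
  edges *m basis_vec j = if (j < m)%N then sheared_basis j.+1 *~ len j else last_edge.
Proof. by rewrite basis_vecE -colE; apply/colP => i; rewrite !mxE. Qed.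

Lemma edges_shear_dir :
  edges *m shear_dir = \sum_(k < m) p0 k *: basis_vec k +
    (tau + (y m')%:Z * len m') *: shear_dir.
Proof.
rewrite /shear_dir mulmxDr mulmx_sumr -/shear_dir.
have := edges_basis_vec ord_max; rewrite /= ltnn => ->.
rewrite (eq_bigr (fun k : 'I_m => ((y k)%:Z * len k) *: sheared_basis k.+1)); last first.
  move=> k _; have := edges_basis_vec (widen_ord (leqnSn _) k); rewrite /= ltn_ord => ek.
  by rewrite -scaler_nat -scalemxAr ek scalez scalerA natz.
rewrite big_ord_recr /= {2}/sheared_basis eqxx /last_edge.
rewrite (eq_bigr (fun k : 'I_m => p0 k *: basis_vec k -
    (if (k : nat) is k'.+1 then (y k')%:Z * len k' else 0) *: basis_vec k)); last first.
  by move=> k _; rewrite scalez -scalerBl.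
rewrite sumrB [X in _ - X]big_ord_recl /= scale0r add0r.
rewrite (eq_bigr (fun k : 'I_m' => ((y k)%:Z * len k) *: sheared_basis k.+1)); last first.
  by move=> k _; rewrite /sheared_basis /= eqSS ltn_eqF.
by rewrite scalez addrACA subrK scalerDl.
Qed.

Hypothesis len_neq0 : forall j, (j < m)%N -> len j != 0.

(** In the basis [sheared_basis], rescaled by the partial products of the [len],
    the matrix [edges] is a companion matrix. *)
Lemma char_poly_edges (k : 'I_m.+1) : (k < m)%N ->
  (char_poly edges)`_k = - (p0 k * \prod_(k <= i < m) len i).
Proof.
move=> km.
pose cum j := \prod_(0 <= i < j) len i.
have cum_neq0 j : (j <= m)%N -> cum j != 0.
  move=> jm; rewrite /cum big_nat prodf_seq_neq0; apply/allP => i _.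
  by apply/implyP => /andP[_ ij]; rewrite len_neq0// (leq_trans ij).
pose B : 'M[int]_m.+1 := \matrix_(i, j) (cum j *: sheared_basis j) i 0.
pose a : 'cV[int]_m.+1 := \col_i (if (i < m)%N then p0 i * \prod_(i <= l < m) len l
   else tau + (y m')%:Z * len m').
have colB j : (j < m.+1)%N -> col (inord j) B = cum j *: sheared_basis j.
  by move=> jm; apply/colP => i; rewrite !mxE inordK.
rewrite (@char_poly_krylov _ edges B a) ?mxE ?km//.
- move=> j jm; have jm' : (j < m.+1)%N by exact: ltnW.
  rewrite !colB// -scalemxAr.
  have := edges_basis_vec (inord j); rewrite inordK// jm.
  rewrite {2}/sheared_basis ltn_eqF// => ->.
  by rewrite scalez scalerA /cum big_nat_recr.
- have BE i j : B i j = (cum j *: sheared_basis j) i 0 by rewrite mxE.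
  have -> : B *m a = \sum_j a j 0 *: (cum j *: sheared_basis j).
    apply/colP => i; rewrite mxE summxE; apply: eq_bigr => j _.
    by rewrite BE [RHS]mxE mulrC.
  have aE j : a j 0 = if (j < m)%N then p0 j * \prod_(j <= l < m) len l
     else tau + (y m')%:Z * len m' by rewrite mxE.
  rewrite colB// -scalemxAr {1}/sheared_basis eqxx edges_shear_dir [RHS]big_ord_recr /=.
  rewrite aE ltnn {2}/sheared_basis eqxx.
  rewrite scalerDr scaler_sumr !scalerA [cum m * _]mulrC; congr (_ + _).
  apply: eq_bigr => l _; rewrite aE /= ltn_ord /sheared_basis ltn_eqF// !scalerA.
  by congr (_ *: _); rewrite /cum (big_cat_nat _ (n := l)) ?(ltnW (ltn_ord l))//=; ring.
rewrite -det_tr det_trig; last first.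
  apply/is_trig_mxP => i j ij; rewrite !mxE /sheared_basis ltn_eqF.
    by rewrite mxE gtn_eqF ?mulr0.
  by rewrite (leq_trans ij)// -ltnS.
apply/prodf_neq0 => i _.
have gi : sheared_basis i i 0 = 1.
  rewrite /sheared_basis; case: eqP => [im|_]; last by rewrite mxE eqxx.
  rewrite mxE summxE big1 => [|j _]; first by rewrite mxE im eqxx addr0.
  by rewrite -scaler_nat !mxE im gtn_eqF// mulr0.
rewrite !mxE gi mulr1; apply: cum_neq0; rewrite -ltnS; exact: ltn_ord.
Qed.

End Simplex.

(** * Trace spectra *)

Lemma Tr_in_TraceSpec (R : realType) (d : nat) (E : set 'cV[int]_d)
    (x : 'cV[int]_d) (A : 'M[int]_d) : E x -> (forall j, E (x + col j A)) ->
  TraceSpec (embedZ R d E) (Tr (map_mx (intr : int -> R) A)).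
Proof.
move=> Ex EA.
exists (fun j => map_mx intr (if unlift ord0 j is Some k then x + col k A else x)).
  by move=> j /=; eexists; last by []; case: unliftP => [k _|_] //=; exact: EA.
congr Tr; apply/matrixP => i j; rewrite !mxE liftK unlift_none !mxE.
by rewrite rmorphD /= addrC addKr.
Qed.

(** The integrality that dictates the powers of [q = N M]: the coefficient of
    degree [k] is multiplied by the [m - k] edge lengths [N n_i], all of which
    divide [q]; the remaining factor [q] provides the divisibility by [N]
    required of the last edge. *)
Lemma scaled_coef (N M m : nat) (n : nat -> nat) (z : int) (k : nat) :
  (k <= m)%N -> (forall j, (j < m)%N -> (n j %| M)%N) ->
  N%:Z * (z * M%:Z * \prod_(k <= i < m) (M %/ n i)%:Z) *
    \prod_(k <= i < m) (N * n i)%:Z = (N * M)%:Z ^+ (m - k).+1 * z.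
Proof.
move=> km nM.
transitivity ((N * M)%:Z * z * \prod_(k <= i < m) (N * M)%:Z).
  rewrite [in RHS](eq_big_nat _ _ (F2 := fun i => (M %/ n i)%:Z * (N * n i)%:Z)).
    by rewrite big_split /= !PoszM; ring.
  by move=> i /andP[_ im]; rewrite -PoszM mulnCA divnK ?nM.
by rewrite prodr_const_nat exprS; ring.
Qed.

Lemma uniform_power_lattice (R : realType) (m' : nat) (b : R) : 0 < b ->
  exists2 q : nat, (0 < q)%N &
  forall E : set 'cV[int]_m'.+2, b < upper_banach_density R m'.+2 E ->
    power_lattice R m'.+2 q `<=` TraceSpec (embedZ R m'.+2 E).
Proof.
move=> b0; pose m := m'.+1.
have [N [M [N0 M0 pattern]]] := @simplex_pattern R 'cV[int]_m'.+2 m b b0.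
exists (N * M)%N; first by rewrite muln_gt0 N0.
move=> E /density_mean[L mL bL] c /choice[z zP].
(* The target of index [i] concerns c_(i+2), the coefficient of degree
   m - 1 - i. *)
pose zn k := oapp z 0 (insub (m - 1 - k)%N).
pose s0 (n : nat -> nat) k : int :=
  (-1) ^+ (m - k) * zn k * M%:Z * \prod_(k <= i < m) (M %/ n i)%:Z.
have [y [n [v [t [nP Ev Ef Ew]]]]] := pattern L mL E bL
  (basis_vec m' m) (basis_vec m')
  (fun y j => sheared_basis m' y j.+1)
  (fun y n k => s0 n k - (if k is k'.+1 then (y k')%:Z * (n k')%:Z else 0)).
pose len j : int := (N * n j)%:Z.
pose p0 k := N%:Z * s0 n k.
pose A := edges m' y len p0 t.
have len_neq0 j : (j < m)%N -> len j != 0.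
  by move=> /nP[n0 _]; rewrite eqz_nat muln_eq0 negb_or -!lt0n N0.
have Acol j : E (v + col j A).
  have [jm|jm] := boolP (j < m)%N.
    have := Ef j jm; congr (E (_ + _)); apply/colP => i.
    by rewrite [RHS]mxE [RHS]mxE jm pmulrn.
  move: Ew; rewrite -addrA; congr (E (_ + _)); apply/colP => i.
  rewrite [RHS]mxE [RHS]mxE (negPf jm); congr (fun_of_matrix _ i 0).
  rewrite /last_edge; congr (_ + _); apply: eq_bigr => k _; congr (_ *~ _).
  rewrite /last_coef /p0 mulrBr; congr (_ - _).
  case: (k : nat) => [|k']; first by rewrite mulr0.
  by rewrite /len PoszM; ring.
suff -> : c = Tr (map_mx (intr : int -> R) A) by exact: (Tr_in_TraceSpec R Ev Acol).
apply/rowP => i; rewrite zP mxE /char_coef -map_char_poly coef_map /=.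
have im : (i < m)%N by have := ltn_ord i; rewrite /m; lia.
pose k := (m - 1 - i)%N.
have km : (k < m)%N by rewrite /k /m; lia.
have -> : (m'.+2 - (i + 2) = k)%N by rewrite /k /m; lia.
have := @char_poly_edges m' y len p0 t len_neq0 (widen_ord (leqnSn _) (Ordinal km)) km.
rewrite /= -/A => ->.
have mk : (m - k = i.+1)%N by rewrite /k /m; lia.
rewrite /p0 /s0 /len.
rewrite (@scaled_coef N M m n _ k (ltnW km)); last by move=> j /nP[].
have znk : zn k = z i.
  rewrite /zn (_ : (m - 1 - k)%N = i) ?valK//; rewrite /k /m; lia.
rewrite znk mk addn2.
rewrite [X in _ = _ * X%:~R](_ : _ = (-1) ^+ i.+2 * ((N * M)%:Z ^+ i.+2 * z i)).
  rewrite [in RHS]rmorphM [in RHS]rmorphXn rmorphN1 signrMK.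
  by rewrite [in RHS]rmorphM [in RHS]rmorphXn.
by rewrite [(-1) ^+ i.+2]exprS mulN1r mulNr mulrCA.
Qed.

Theorem theorem2 (R : realType) (d : nat) (hd : (2 <= d)%N) :
  exists q : R -> nat,
    forall E : set 'cV[int]_d,
      0 < upper_banach_density R d E ->
      (0 < q (upper_banach_density R d E))%N /\
      power_lattice R d (q (upper_banach_density R d E))
        `<=` TraceSpec (embedZ R d E).
Proof.
case: d hd => [//|[//|m']] _.
have /choice[q qP] : forall b : R, exists q : nat, 0 < b ->
    (0 < q)%N /\ forall E : set 'cV[int]_m'.+2,
      b / 2 < upper_banach_density R m'.+2 E ->
      power_lattice R m'.+2 q `<=` TraceSpec (embedZ R m'.+2 E).
  move=> b; have [b0|nb] := boolP (0 < b); last by exists 0%N.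
  (* Any bound strictly below the density yields boxes, hence a mean. *)
  have [q q0 qE] := @uniform_power_lattice R m' (b / 2) (divr_gt0 b0 (ltr0n _ 2)).
  by exists q.
exists q => E E0; have [q0 qE] := qP _ E0; split=> //.
by apply: qE; rewrite ltr_pdivrMr// ltr_pMr// ltr1n.
Qed.
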